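(* The causal theory $\mathsf{HP}$ does not satisfy the principle of presumption. Specifically, let $\mathcal S_2$ be the causal structure with exogenous variables $U_1,U_2$, endogenous variables $J_1,J_2,B$, and ranges $\mathcal R(U_1)=\mathcal R(J_1)=\{0,0.5\}$, $\mathcal R(U_2)=\mathcal R(J_2)=\{0,0.5,1\}$, $\mathcal R(B)=\{0,1\}$. Let $M_2$ be the causal model over $\mathcal S_2$ whose graph has exactly the edges $J_1\to B$ and $J_2\to B$, whose equations are $J_1=U_1$, $J_2=U_2$, and $B=0$ if $J_1+J_2\ge 1$, $B=1$ otherwise, and whose context is $U_1=0.5$, $U_2=1$. Then for $M=M_2$, $\phi=(B=0)$ and $V=J_1$ the condition in the principle of presumption fails for $\mathsf{Cause}=\mathsf{HP}$.
   Context: Causal structure: a tuple $\mathcal S=(\mathcal U,\mathcal V,\mathcal R)$ with $\mathcal U$ a finite set of exogenous variables, $\mathcal V$ a finite set of endogenous variables, and $\mathcal R$ assigning to every variable $X\in\mathcal U\cup\mathcal V$ a finite set $\mathcal R(X)$ of values (its range). Causal model over $\mathcal S$: a tuple $M=(\mathsf G,\mathcal F,\vec u)$ where $\mathsf G$ is a directed acyclic graph with vertex set $\mathcal V$; $\mathcal F=(F_V)_{V\in\mathcal V}$ where, with $p(V)$ the set of parents of $V$ in $\mathsf G$, $F_V:\prod_{U\in\mathcal U\cup p(V)}\mathcal R(U)\to\mathcal R(V)$; and $\vec u$ (the context) gives each $U\in\mathcal U$ a value in $\mathcal R(U)$. By acyclicity the system of equations ''$V=F_V(\ldots)$ for all $V\in\mathcal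 V$'', with exogenous values given by $\vec u$, has a unique solution $S_M$. Basic formulas: Boolean combinations of atoms $(V=v)$ with $V\in\mathcal V$, $v\in\mathcal R(V)$. $M\models(V=v)$ iff $S_M(V)=v$; Boolean connectives are interpreted as usual. Interventions: for $\vec X\subseteq\mathcal V$ and an assignment $\vec x$ of range-permitted values to $\vec X$, $M_{[\vec X\leftarrow\vec x]}$ is the model obtained from $M$ by replacing $F_{X_i}$ by the constant $x_i$ for every $X_i\in\vec X$. If $\vec x$ is a partial assignment on $\vec X$, variables of $\vec X$ with no value in $\vec x$ keep their equations. $M\models[\vec X\leftarrow\vec x]\phi$ means $M_{[\vec X\leftarrow\vec x]}\models\phi$. Several assignments inside the brackets are all performed; if a variable is assigned more than once, the later assignment prevails. Causal theory: a map $\mathsf{Cause}$ with $\mathsf{Cause}(M,\phi)\subseteq\mathcal V$ for all models $M$ and basic formulas $\phi$ over $\mathcal S$. But-for theory: $X\in\mathsf{ButFor}(M,\phi)$ iff $M\models\phi$ and there is $x\in\mathcal R(X)$ with $M\models[X\leftarrow x]\neg\phi$. HP theory: $\vec X\subseteq\mathcal V$ is a complex cause of $\phi$ in $M$ if (AC1) $M\models\phi$; (AC2) there are a set $\vec W\subseteq\mathcal V$ and a setting $\vec x$ of values for $\vec X$ such that $M\models[\vec W\leftarrow\vec w,\vec X\leftarrow\vec x]\neg\phi$, where $\vec w$ are the actual values of $\vec W$, i.e. $M\models(\vec W=\vec w)$; (AC3) no proper subset of $\vec X$ satisfies AC1 and AC2. Then $\mathsf{HP}(M,\phi)=\{V\in\mathcal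 V\mid V\in\vec X\text{ for some complex cause }\vec X\text{ of }\phi\text{ in }M\}$. Counterfactual models: for $\vec X\subseteq\mathcal V$ with complement $c(\vec X)=\mathcal V\setminus\vec X$, $\mathcal M(\vec X)$ is the set of all models $M_{[\vec X\leftarrow\vec v,\,c(\vec X)\leftarrow\vec w]}$ where $\vec v$ is any partial assignment of range-permitted values to $\vec X$ and $\vec w$ is any partial assignment to $c(\vec X)$ consisting of actual values (each $w_i\in\vec w$ for $W_i$ satisfies $M\models(W_i=w_i)$). Relative to a causal theory $\mathsf{Cause}$: $V$ is a putative cause of $\phi$ in $M$ if there is $M'\in\mathcal M(\mathsf{Cause}(M,\phi))$ with $S_M(V)=S_{M'}(V)$ and $V\in\mathsf{ButFor}(M',\phi)$. $V$ is a preempted cause of $\phi$ in $M$ if it is a putative cause of $\phi$ in $M$ but $V\notin\mathsf{Cause}(M,\phi)$. Principle of presumption: $\mathsf{Cause}$ satisfies it if for all $M,\phi,V$ the following condition holds: if $V$ is a preempted cause of $\phi$ in $M$, then for all $M'\in\mathcal M(\mathsf{Cause}(M,\phi))$ such that $S_{M'}(V)=S_M(V)$ and $V\in\mathsf{ButFor}(M',\phi)$, there is $W\in\mathcal V\setminus\mathsf{Cause}(M,\phi)$ such that $S_M(W)\neq S_{M'}(W)$. *)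

(* Defs.v *)
From HB Require Import structures.
From mathcomp Require Import all_boot all_order all_algebra.
From mathcomp Require Import boolp.

Set Implicit Arguments.
Unset Strict Implicit.
Unset Printing Implicit Defensive.

Import Order.TTheory GRing.Theory Num.Theory.

(* The ranges of the exogenous and of the endogenous variables are two separate
   families, so that the two kinds of variables are disjoint by construction. *)
Record structure := Structure {
  exo : finType;
  endo : finType;
  exo_range : exo -> finType;
  endo_range : endo -> finType
}.

Definition acyclic (T : eqType) (e : rel T) :=
  forall c : seq T, cycle e c -> c = [::].

Definition context (S : structure) := forall u : exo S, exo_range u.
Definition valuation (S : structure) := forall v : endo S, endo_range v.

Definition parents (S : structure) (e : rel (endo S)) (v : endo S) : Type :=
  {w : endo S | e w v}.

(* [edge w v] is the arrow from w to v. The argument of [eqn v], an element of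
   the product of the ranges over U and p(v), is given in two parts. *)
Record model (S : structure) := Model {
  edge : rel (endo S);
  edge_acyclic : acyclic edge;
  eqn : forall v : endo S,
    context S -> (forall w : parents edge v, endo_range (val w)) -> endo_range v;
  ctx : context S
}.

Definition solves (S : structure) (M : model S) (s : valuation S) :=
  forall v : endo S, s v = eqn (ctx M) (fun w : parents (edge M) v => s (val w)).

Lemma acyclic_wf (T : finType) (e : rel T) :
  acyclic e -> well_founded (fun x y => e x y).
Proof.
move=> acy.
pose A (x : T) := [set z | connect e z x].
have ltA x y : e x y -> A x \proper A y.
  move=> exy; apply/properP; split.
    apply/subsetP => z; rewrite !inE => zx.
    exact: connect_trans zx (connect1 exy).
  exists y; rewrite !inE ?connect0 //.
  apply/negP => /connectP[p yp xE].
  suff: x :: (y :: p) = [::] by [].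
  case: (lastP p) yp xE => [|q z] /=.
    by move=> _ xy; have := acy [:: x]; rewrite /= {2}xy exy => /(_ isT).
  rewrite last_rcons => yq xz; subst z.
  have := acy (x :: y :: q).
  by rewrite /= exy yq => /(_ isT).
have Acc_n n : forall x, #|A x| < n -> Acc (fun x y => e x y) x.
  elim: n => [x|n IHn x ltx]; first by rewrite ltn0.
  constructor => y /ltA/proper_card lty.
  exact: IHn (leq_trans lty ltx).
by move=> x; apply: (Acc_n #|A x|.+1); apply: ltnSn.
Qed.

Definition solution (S : structure) (M : model S) : valuation S :=
  Fix (acyclic_wf (@edge_acyclic S M)) (fun v => endo_range v : Type)
    (fun v rec => eqn (ctx M)
       (fun w : parents (edge M) v => rec (val w) (valP w))).

Lemma solutionP (S : structure) (M : model S) : solves M (solution M).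
Proof.
move=> v; rewrite /solution Fix_eq // => x f g fg.
by congr eqn; apply: functional_extensionality_dep => w; apply: fg.
Qed.

Lemma solution_unique (S : structure) (M : model S) (s : valuation S) :
  solves M s -> forall v, s v = solution M v.
Proof.
move=> sM; apply: (well_founded_ind (acyclic_wf (@edge_acyclic S M))) => v IHv.
rewrite sM solutionP; congr eqn.
by apply: functional_extensionality_dep => w; exact: IHv (valP w).
Qed.

Inductive formula (S : structure) : Type :=
  | Atom (v : endo S) (a : endo_range v)
  | Not of formula S
  | And of formula S & formula S
  | Or of formula S & formula S.

Fixpoint sat (S : structure) (M : model S) (phi : formula S) : bool :=
  match phi with
  | Atom v a => solution M v == a
  | Not phi1 => ~~ sat M phi1
  | And phi1 phi2 => sat M phi1 && sat M phi2
  | Or phi1 phi2 => sat M phi1 || sat M phi2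
  end.

(* [p v = None] means that p gives no value to v. *)
Definition passign (S : structure) := forall v : endo S, option (endo_range v).

Definition partial_on (S : structure) (X : {set endo S}) (p : passign S) :=
  forall v, p v -> v \in X.

Definition setting_of (S : structure) (X : {set endo S}) (p : passign S) :=
  forall v, (p v : bool) = (v \in X).

Definition actual (S : structure) (M : model S) (p : passign S) :=
  forall v a, p v = Some a -> sat M (Atom a).

Definition assign1 (S : structure) (v : endo S) (a : endo_range v) : passign S :=
  dfwith (fun w : endo S => None : option (endo_range w)) (Some a).

(* p followed by q: on a variable assigned by both, the value of q prevails. *)
Definition seq_assign (S : structure) (p q : passign S) : passign S :=
  fun v => if q v is Some a then Some a else p v.

(* The graph is unchanged: an assigned variable keeps its parents, but its new
   equation is constant. *)
Definition intervene (S : structure) (M : model S) (p : passign S) : model S :=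
  {| edge := edge M;
     edge_acyclic := @edge_acyclic S M;
     eqn := fun v u f => if p v is Some a then a else eqn u f;
     ctx := ctx M |}.

Definition causal_theory (S : structure) := model S -> formula S -> {set endo S}.

Definition ButFor (S : structure) : causal_theory S := fun M phi =>
  [set X | sat M phi
           && [exists x : endo_range X, sat (intervene M (assign1 x)) (Not phi)]].

Definition AC1 (S : structure) (M : model S) (phi : formula S) : Prop :=
  sat M phi.

Definition AC2 (S : structure) (M : model S) (phi : formula S)
    (X : {set endo S}) : Prop :=
  exists (W : {set endo S}) (w x : passign S),
    [/\ setting_of W w, actual M w, setting_of X x
      & sat (intervene M (seq_assign w x)) (Not phi)].

Definition complex_cause (S : structure) (M : model S) (phi : formula S)
    (X : {set endo S}) : Prop :=
  [/\ AC1 M phi, AC2 M phi X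
    & forall Y : {set endo S}, Y \proper X -> ~ (AC1 M phi /\ AC2 M phi Y)].

Definition HP (S : structure) : causal_theory S := fun M phi =>
  [set V | `[< exists X : {set endo S}, complex_cause M phi X /\ V \in X >]].

Definition counterfactual (S : structure) (M : model S) (X : {set endo S})
    (M' : model S) : Prop :=
  exists v w : passign S,
    [/\ partial_on X v, partial_on (~: X) w, actual M w
      & M' = intervene M (seq_assign v w)].

Definition putative_cause (S : structure) (Cause : causal_theory S)
    (M : model S) (phi : formula S) (V : endo S) : Prop :=
  exists M' : model S,
    [/\ counterfactual M (Cause M phi) M', solution M V = solution M' V
      & V \in ButFor M' phi].

Definition preempted_cause (S : structure) (Cause : causal_theory S)
    (M : model S) (phi : formula S) (V : endo S) : Prop :=
  putative_cause Cause M phi V /\ V \notin Cause M phi.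

Definition presumption_at (S : structure) (Cause : causal_theory S)
    (M : model S) (phi : formula S) (V : endo S) : Prop :=
  preempted_cause Cause M phi V ->
  forall M' : model S,
    counterfactual M (Cause M phi) M' ->
    solution M' V = solution M V ->
    V \in ButFor M' phi ->
    exists2 W : endo S, W \notin Cause M phi & solution M W <> solution M' W.

Definition presumption (S : structure) (Cause : causal_theory S) : Prop :=
  forall (M : model S) (phi : formula S) (V : endo S),
    presumption_at Cause M phi V.

Inductive exo2 := U1 | U2.
Inductive endo2 := J1 | J2 | B.

Definition exo2_code (u : exo2) : 'I_2 :=
  match u with U1 => @Ordinal 2 0 isT | U2 => @Ordinal 2 1 isT end.
Definition exo2_decode (i : 'I_2) : exo2 := nth U1 [:: U1; U2] i.
Lemma exo2_codeK : cancel exo2_code exo2_decode.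
Proof. by case. Qed.
HB.instance Definition _ := Finite.copy exo2 (can_type exo2_codeK).

Definition endo2_code (v : endo2) : 'I_3 :=
  match v with
  | J1 => @Ordinal 3 0 isT
  | J2 => @Ordinal 3 1 isT
  | B => @Ordinal 3 2 isT
  end.
Definition endo2_decode (i : 'I_3) : endo2 := nth J1 [:: J1; J2; B] i.
Lemma endo2_codeK : cancel endo2_code endo2_decode.
Proof. by case. Qed.
HB.instance Definition _ := Finite.copy endo2 (can_type endo2_codeK).

Local Open Scope ring_scope.

Definition one_half : rat := 2^-1.

Definition range_0h : finType := seq_sub [:: 0; one_half].
Definition range_0h1 : finType := seq_sub [:: 0; one_half; 1].
Definition range_01 : finType := seq_sub [:: 0; 1 : rat].

Definition exo_range2 (u : exo2) : finType :=
  match u with U1 => range_0h | U2 => range_0h1 end.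
Definition endo_range2 (v : endo2) : finType :=
  match v with J1 => range_0h | J2 => range_0h1 | B => range_01 end.

Definition S2 : structure := Structure exo_range2 endo_range2.

Fact half_in_0h : one_half \in [:: 0; one_half].
Proof. by rewrite !inE eqxx orbT. Qed.
Fact one_in_0h1 : 1 \in [:: 0; one_half; 1].
Proof. by rewrite !inE eqxx !orbT. Qed.
Fact zero_in_01 : 0 \in [:: 0; 1 : rat].
Proof. by rewrite !inE eqxx. Qed.
Fact one_in_01 : 1 \in [:: 0; 1 : rat].
Proof. by rewrite !inE eqxx orbT. Qed.

Definition B0 : endo_range (B : endo S2) := SeqSub zero_in_01.
Definition B1 : endo_range (B : endo S2) := SeqSub one_in_01.

Definition edge2 : rel (endo S2) := fun w v =>
  match w, v with
  | J1, B | J2, B => true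
  | _, _ => false
  end.

Lemma edge2_acyclic : acyclic edge2.
Proof.
case=> [//|x [|y c]] /=; first by case: x.
case/andP; case: x => //; case: y => // _; by case: c => [|[]].
Qed.

Definition eqn2 (v : endo S2) :
    context S2 -> (forall w : parents edge2 v, endo_range (val w)) -> endo_range v :=
  match v as v0 return
    context S2 ->
    (forall w : @parents S2 edge2 v0, endo_range (val w)) -> @endo_range S2 v0
  with
  | J1 => fun u _ => u U1
  | J2 => fun u _ => u U2
  | B => fun _ f =>
      let j1 : range_0h := f (exist _ (J1 : endo S2) isT) in
      let j2 : range_0h1 := f (exist _ (J2 : endo S2) isT) in
      if 1 <= ssval j1 + ssval j2 then B0 else B1
  end.

Definition ctx2 : context S2 := fun u : exo2 =>
  match u return exo_range2 u with
  | U1 => SeqSub half_in_0h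
  | U2 => SeqSub one_in_0h1
  end.

Definition M2 : model S2 :=
  {| edge := edge2; edge_acyclic := edge2_acyclic;
     eqn := eqn2; ctx := ctx2 |}.

(* Main.v *)
(** Setting [J2] to [0] makes [B = 1], and so does setting [B] to [1]; if
    neither is changed, then [J1 + J2 >= 1] for every value of [J1]. So a set
    satisfies AC2 iff it contains [J2] or [B], and by minimality [J1] is in no
    complex cause although [J2] is. In the counterfactual model where
    [J2 = 0.5], the value of [J1] is actual and decides [B], so [J1] is
    preempted. Only [J2] has changed there, and [J2] is a cause, so no variable
    outside [HP] has a new value. *)
From mathcomp Require Import all_boot all_order all_algebra.
From mathcomp Require Import boolp.
Require Import Defs.

Set Implicit Arguments.
Unset Strict Implicit.
Unset Printing Implicit Defensive.

Import Order.TTheory GRing.Theory Num.Theory.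
Local Open Scope ring_scope.

Lemma solution_intervene (S : structure) (M : model S) (p : passign S)
    (v : endo S) :
  solution (intervene M p) v =
  if p v is Some a then a
  else eqn (ctx M) (fun w : parents (edge M) v =>
                      solution (intervene M p) (val w)).
Proof. by rewrite solutionP. Qed.

(** Lets the but-for test inside [M2_half] be computed as a single intervention on [M2]. *)
Lemma intervene_intervene (S : structure) (M : model S) (p q : passign S) :
  intervene (intervene M p) q = intervene M (seq_assign p q).
Proof.
congr Model; do 3 apply: functional_extensionality_dep => ?.
by rewrite /seq_assign /=; case: (q _).
Qed.

Lemma assign1_eq (S : structure) (v : endo S) (a : endo_range v) :
  assign1 a v = Some a.
Proof. by rewrite /assign1 dfwith_in. Qed.

Lemma assign1_neq (S : structure) (v w : endo S) (a : endo_range v) :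
  v != w -> assign1 a w = None.
Proof. by move=> vw; rewrite /assign1 dfwith_out. Qed.

Lemma setting_assign1 (S : structure) (v : endo S) (a : endo_range v) :
  setting_of [set v] (assign1 a).
Proof.
move=> w; rewrite inE eq_sym; case: (eqVneq v w) => [vw|vw].
  by rewrite -vw assign1_eq.
by rewrite assign1_neq.
Qed.

(** But-for dependence is the case of AC2 in which [W] is empty. *)
Lemma AC2_assign1 (S : structure) (M : model S) (phi : formula S)
    (v : endo S) (a : endo_range v) :
  sat (intervene M (assign1 a)) (Not phi) -> AC2 M phi [set v].
Proof.
move=> sata; exists set0, (fun=> None), (assign1 a); split => //.
- by move=> w; rewrite inE.
- exact: setting_assign1.
- suff -> : seq_assign (fun=> None) (assign1 a) = assign1 a by [].
  apply: functional_extensionality_dep => w.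
  by rewrite /seq_assign; case: (assign1 a w).
Qed.

Definition J1_0 : endo_range (J1 : endo S2) :=
  @SeqSub _ [:: 0; one_half] 0 (mem_head _ _).
Definition J2_0 : endo_range (J2 : endo S2) :=
  @SeqSub _ [:: 0; one_half; 1] 0 (mem_head _ _).

Fact half_in_0h1 : one_half \in [:: 0; one_half; 1].
Proof. by rewrite !inE eqxx orbT. Qed.

Definition J2_half : endo_range (J2 : endo S2) := SeqSub half_in_0h1.

Lemma range_0h_ge0 (a : range_0h) : 0 <= ssval a.
Proof. by case: a => a /=; rewrite !inE => /orP[] /eqP->. Qed.

Lemma solution_M2_J1 : solution M2 J1 = ctx2 U1.
Proof. by rewrite solutionP. Qed.

Lemma solution_M2_J2 : solution M2 J2 = ctx2 U2.
Proof. by rewrite solutionP. Qed.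

Lemma solution_M2_B : solution M2 B = B0.
Proof. by rewrite solutionP /= solution_M2_J1 solution_M2_J2. Qed.

Lemma solution_do_J1 (p : passign S2) :
  solution (intervene M2 p) J1 = odflt (ctx2 U1) (p J1).
Proof. by rewrite solution_intervene; case: (p J1). Qed.

Lemma solution_do_J2 (p : passign S2) :
  solution (intervene M2 p) J2 = odflt (ctx2 U2) (p J2).
Proof. by rewrite solution_intervene; case: (p J2). Qed.

(** The [odflt] defaults are what the equations give when [p] leaves a variable free. *)
Lemma solution_do_B (p : passign S2) :
  solution (intervene M2 p) B =
  odflt (if 1 <= ssval (odflt (ctx2 U1 : range_0h) (p J1))
               + ssval (odflt (ctx2 U2 : range_0h1) (p J2))
         then B0 else B1) (p B).
Proof.
by rewrite solution_intervene; case: (p B) => //=;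
  rewrite solution_do_J1 solution_do_J2.
Qed.

Lemma AC2_J2 : AC2 M2 (Atom B0) [set (J2 : endo S2)].
Proof.
apply: (@AC2_assign1 S2 M2 (Atom B0) J2 J2_0) => /=.
by rewrite solution_do_B assign1_eq !assign1_neq.
Qed.

Lemma AC2_B : AC2 M2 (Atom B0) [set (B : endo S2)].
Proof.
apply: (@AC2_assign1 S2 M2 (Atom B0) B B1) => /=.
by rewrite solution_do_B assign1_eq.
Qed.

(** If [X] avoids [J2] and [B], only [w] can assign them, and only their actual values. Then [B] is
    either frozen at 0 or computed from [J2 = 1] and some [J1 >= 0]. *)
Lemma AC2_M2_mem (X : {set endo S2}) :
  AC2 M2 (Atom B0) X -> ((J2 : endo S2) \in X) || ((B : endo S2) \in X).
Proof.
case=> [W [w [x [_ aw xX]]]]; apply: contraLR => /norP[J2X BX].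
have xJ2 : x J2 = None by have := xX J2; rewrite (negbTE J2X); case: (x J2).
have xB : x B = None by have := xX B; rewrite (negbTE BX); case: (x B).
(* Only the values at [J2] and [B] are unfolded; the one at [J1] stays arbitrary. *)
rewrite /= negbK solution_do_B {2 3}/seq_assign xJ2 xB.
case wB: (w B) => [b|] /=.
  by have /eqP <- := aw _ _ wB; rewrite solution_M2_B.
have -> : odflt (ctx2 U2 : range_0h1) (w J2) = ctx2 U2.
  case wJ2: (w J2) => [b|] //=.
  by have /eqP <- := aw _ _ wJ2; rewrite solution_M2_J2.
by rewrite /= lerDr range_0h_ge0.
Qed.

Lemma sat_M2 : AC1 M2 (Atom B0).
Proof. by rewrite /AC1 /= solution_M2_B. Qed.

Lemma J2_in_HP : (J2 : endo S2) \in HP M2 (Atom B0).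
Proof.
rewrite inE; apply/asboolP; exists [set (J2 : endo S2)].
split; last by rewrite inE.
split; [exact: sat_M2 | exact: AC2_J2 |].
(* A proper subset of [[set J2]] contains neither [J2] nor [B]. *)
move=> Y /properP[/subsetP YJ2 [v]]; rewrite inE => /eqP-> J2Y [_ /AC2_M2_mem].
by rewrite (negbTE J2Y) => /YJ2; rewrite inE.
Qed.

Lemma J1_notin_HP : (J1 : endo S2) \notin HP M2 (Atom B0).
Proof.
rewrite inE; apply/asboolP => -[X [[_ AC2X minX] J1X]].
(* As [J1] lies in [X], such a singleton is a proper subset of [X], against minimality. *)
have single (v : endo S2) :
    v != J1 -> v \in X -> AC2 M2 (Atom B0) [set v] -> False.
  move=> vJ1 vX AC2v; apply: (minX [set v]); last by split; [exact: sat_M2|].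
  apply/properP; split; first by rewrite sub1set.
  by exists J1; rewrite // inE eq_sym.
case/orP: (AC2_M2_mem AC2X) => vX.
- exact: single vX AC2_J2.
- exact: single vX AC2_B.
Qed.

Definition M2_half : model S2 := intervene M2 (assign1 J2_half).

(** [J2] may take a non-actual value because it belongs to [HP]; nothing is frozen outside. *)
Lemma counterfactual_M2_half : counterfactual M2 (HP M2 (Atom B0)) M2_half.
Proof.
exists (assign1 J2_half), (fun=> None); split => //.
move=> v; rewrite (setting_assign1 J2_half v) inE => /eqP->.
exact: J2_in_HP.
Qed.

Lemma solution_M2_half_J1 : solution M2_half J1 = solution M2 J1.
Proof. by rewrite solution_do_J1 assign1_neq // solution_M2_J1. Qed.

(** The threshold is met with equality, 0.5 + 0.5 = 1, so any decrease of [J1] flips [B]. *)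
Lemma solution_M2_half_B : solution M2_half B = solution M2 B.
Proof.
by rewrite solution_do_B assign1_eq !assign1_neq // solution_M2_B.
Qed.

Lemma J1_ButFor_M2_half : (J1 : endo S2) \in ButFor M2_half (Atom B0).
Proof.
rewrite inE /= solution_M2_half_B solution_M2_B eqxx /=.
apply/existsP; exists J1_0; rewrite intervene_intervene solution_do_B /seq_assign.
by rewrite (assign1_eq J1_0) !(assign1_neq J1_0) // assign1_eq !assign1_neq.
Qed.

Theorem mainTheorem3 :
  ~ presumption (@HP S2) /\ ~ presumption_at (@HP S2) M2 (Atom B0) J1.
Proof.
suff fail_at : ~ presumption_at (@HP S2) M2 (Atom B0) J1.
  by split=> // /(_ M2 (Atom B0) J1).
move=> pres.
(* [M2_half] serves twice: it makes [J1] a putative cause and it refutes the conclusion. *)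
have [|W WHP] := pres _ _ counterfactual_M2_half solution_M2_half_J1
  J1_ButFor_M2_half.
  split; last exact: J1_notin_HP.
  exists M2_half; split;
    [exact: counterfactual_M2_half | | exact: J1_ButFor_M2_half].
  by rewrite solution_M2_half_J1.
case: W WHP => [_|J2HP _|_].
- by rewrite solution_M2_half_J1.
- by rewrite J2_in_HP in J2HP.
- by rewrite solution_M2_half_B.
Qed.
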